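(* For $t\in[0,1]$ let $\sigma(t)=(1-t)i+tj\in\mathbb{H}_s$ and $\mathbb{K}_t=\mathbb{R}+\sigma(t)\mathbb{R}\subset\mathbb{H}_s$. Then $\mathbb{K}_t$ is a subalgebra of $\mathbb{H}_s$ and $$\mathbb{K}_t\simeq\begin{cases}\mathbb{C}, & 0\le t<1/2,\\ \mathbb{D}, & t=1/2,\\ \mathbb{C}_s, & 1/2<t\le1.\end{cases}$$ For every $n$ and $t\in[0,1]$ the map $$\mathbb{P}^n_{\mathbb{K}_t}\to\mathbb{P}^n_{\mathbb{H}_s},\qquad [z_0:\cdots:z_n]\mapsto[z_0:\cdots:z_n],$$ is an embedding. For $n=1$ and the Hermitian forms $\langle u,v\rangle=u_1v_1^*+u_2v_2^*$ on $\mathbb{K}_t^2$ and on $\mathbb{H}_s^2$, these embeddings, restricted to the regular regions, are isometric.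
   Context: $\mathbb{H}_s=\mathbb{R}+i\mathbb{R}+j\mathbb{R}+k\mathbb{R}$ denotes the split-quaternions: $i^2=-1$, $j^2=k^2=1$, $ij=k$, and $i,j,k$ pairwise anticommute, with involution $(x+iy+jz+kw)^*=x-iy-jz-kw$. $\mathbb{D}=\mathbb{R}[x]/(x^2)$ denotes the dual numbers and $\mathbb{C}_s=\mathbb{R}[x]/(x^2-1)$ the split-complex numbers, each with the involution $x\mapsto -x$; $\mathbb{C}$ has complex conjugation. Each $\mathbb{K}_t$ carries the involution restricted from $\mathbb{H}_s$. For such an algebra $\mathbb{F}$ with group of units $\mathbb{F}^\times$, a vector $u$ in the free left module $\mathbb{F}^{n+1}$ is good if $\sum_iu_i\mathbb{F}=\mathbb{F}$, and $\mathbb{P}^n_{\mathbb{F}}:=(\mathbb{F}^{n+1})^\bullet/\mathbb{F}^\times$, where $(\mathbb{F}^{n+1})^\bullet$ is the open set of good vectors; it is a smooth manifold such that the quotient map is a principal $\mathbb{F}^\times$-bundle. Given the Hermitian form, the regular region is $\{[p]:\langle p,p\rangle\neq0\}$. The tangent space at a regular point $[p]$ is identified with the $\mathbb{F}$-linear maps $\phi:\mathbb{F}p\to p^\perp$, $p^\perp=\{v:\langle v,p\rangle=0\}$ ($\phi$ is the velocity at $\epsilon=0$ of $\epsilon\mapsto[p+\epsilon\phi(p)]$), and the metric on the regular region is $g_{[p]}(\phi,\psi)=\mathrm{Re}\frac{\langle\phi(p),\psi(p)\rangle}{\langle p,p\rangle}$, $\mathrm{Re}\,u=(u+u^* )/2$.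 ''Isometric'' means that regular points are mapped to regular points and that the metric of the target pulls back to the metric of the source. *)

(* Defs.v *)
(* The field of real numbers is an arbitrary realType. *)
From HB Require Import structures.
From mathcomp Require Import all_boot all_order all_algebra.
From mathcomp Require Import falgebra complex ring.
From mathcomp Require Import all_classical all_reals all_analysis.

Set Implicit Arguments.
Unset Strict Implicit.
Unset Printing Implicit Defensive.

Import Order.TTheory GRing.Theory Num.Theory.
Import numFieldNormedType.Exports.

Local Open Scope classical_set_scope.
Local Open Scope ring_scope.
Local Open Scope quotient_scope.

(* SplitQuat a b c d stands for a + ib + jc + kd. *)
Record splitquat (R : realType) :=
  SplitQuat { sq1 : R; sqi : R; sqj : R; sqk : R }.

Section SplitQuaternions.
Context {R : realType}.
Implicit Types u v w : splitquat R.

Definition sq_tuple u := (sq1 u, sqi u, sqj u, sqk u).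
Definition tuple_sq (x : R * R * R * R) := let: (a, b, c, d) := x in SplitQuat a b c d.
Lemma sq_tupleK : cancel sq_tuple tuple_sq. Proof. by case. Qed.

HB.instance Definition _ := Choice.copy (splitquat R) (can_type sq_tupleK).

Lemma sq_eq u v : sq1 u = sq1 v -> sqi u = sqi v -> sqj u = sqj v ->
  sqk u = sqk v -> u = v.
Proof. by case: u v => [a b c d] [a' b' c' d'] /= -> -> -> ->. Qed.

Definition sq_zero : splitquat R := SplitQuat 0 0 0 0.
Definition sq_opp u := SplitQuat (- sq1 u) (- sqi u) (- sqj u) (- sqk u).
Definition sq_add u v :=
  SplitQuat (sq1 u + sq1 v) (sqi u + sqi v) (sqj u + sqj v) (sqk u + sqk v).
Definition sq_scale (a : R) u :=
  SplitQuat (a * sq1 u) (a * sqi u) (a * sqj u) (a * sqk u).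
Definition sq_one : splitquat R := SplitQuat 1 0 0 0.
(* From i^2 = -1, j^2 = k^2 = 1, ij = k and anticommutation: jk = -i, ki = j. *)
Definition sq_mul u v := SplitQuat
  (sq1 u * sq1 v - sqi u * sqi v + sqj u * sqj v + sqk u * sqk v)
  (sq1 u * sqi v + sqi u * sq1 v - sqj u * sqk v + sqk u * sqj v)
  (sq1 u * sqj v + sqj u * sq1 v - sqi u * sqk v + sqk u * sqi v)
  (sq1 u * sqk v + sqk u * sq1 v + sqi u * sqj v - sqj u * sqi v).

Let sq_addA : associative sq_add.
Proof. by move=> u v w; apply: sq_eq; exact: addrA. Qed.
Let sq_addC : commutative sq_add.
Proof. by move=> u v; apply: sq_eq; exact: addrC. Qed.
Let sq_add0 : left_id sq_zero sq_add.
Proof. by move=> u; apply: sq_eq; exact: add0r. Qed.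
Let sq_addN : left_inverse sq_zero sq_opp sq_add.
Proof. by move=> u; apply: sq_eq; exact: addNr. Qed.
HB.instance Definition _ :=
  GRing.isZmodule.Build (splitquat R) sq_addA sq_addC sq_add0 sq_addN.

Let sq_mulA : associative sq_mul.
Proof. by move=> u v w; apply: sq_eq => /=; ring. Qed.
Let sq_mul1l : left_id sq_one sq_mul.
Proof. by move=> u; apply: sq_eq => /=; ring. Qed.
Let sq_mul1r : right_id sq_one sq_mul.
Proof. by move=> u; apply: sq_eq => /=; ring. Qed.
Let sq_mulDl : left_distributive sq_mul +%R.
Proof. by move=> u v w; apply: sq_eq => /=; ring. Qed.
Let sq_mulDr : right_distributive sq_mul +%R.
Proof. by move=> u v w; apply: sq_eq => /=; ring. Qed.
Let sq_one_neq0 : sq_one != 0.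
Proof. by apply/eqP => /(congr1 (@sq1 R))/eqP; rewrite oner_eq0. Qed.
HB.instance Definition _ := GRing.Zmodule_isNzRing.Build (splitquat R)
  sq_mulA sq_mul1l sq_mul1r sq_mulDl sq_mulDr sq_one_neq0.

Let sq_scaleA (a b : R) u : sq_scale a (sq_scale b u) = sq_scale (a * b) u.
Proof. by apply: sq_eq; exact: mulrA. Qed.
Let sq_scale1 : left_id 1 sq_scale.
Proof. by move=> u; apply: sq_eq; exact: mul1r. Qed.
Let sq_scaleDr : right_distributive sq_scale +%R.
Proof. by move=> a u v; apply: sq_eq; exact: mulrDr. Qed.
Let sq_scaleDl u : {morph sq_scale^~ u : a b / a + b}.
Proof. by move=> a b; apply: sq_eq; exact: mulrDl. Qed.
HB.instance Definition _ := GRing.Zmodule_isLmodule.Build R (splitquat R)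
  sq_scaleA sq_scale1 sq_scaleDr sq_scaleDl.

Let sq_scaleAl (a : R) u v : a *: (u * v) = (a *: u) * v.
Proof. by apply: sq_eq => /=; ring. Qed.
HB.instance Definition _ := GRing.Lmodule_isLalgebra.Build R (splitquat R) sq_scaleAl.
Let sq_scaleAr (a : R) u v : a *: (u * v) = u * (a *: v).
Proof. by apply: sq_eq => /=; ring. Qed.
HB.instance Definition _ := GRing.Lalgebra_isAlgebra.Build R (splitquat R) sq_scaleAr.

Let sq_vect_iso : Vector.axiom 4 (splitquat R).
Proof.
pose f u : 'rV[R]_4 := \row_i [tuple sq1 u; sqi u; sqj u; sqk u]`_i.
pose g (x : 'rV[R]_4) := SplitQuat (x 0 0) (x 0 1) (x 0 2%:R) (x 0 3%:R).
exists f; first by move=> a u v; apply/rowP => i; rewrite !mxE; case: i => -[|[|[|[|]]]].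
exists g; first by case=> a b c d; rewrite /g !mxE.
move=> x; apply/rowP => i; rewrite mxE.
by case: i => -[|[|[|[|//]]]] Hi /=; congr (x 0 _); apply: val_inj.
Qed.
HB.instance Definition _ := Lmodule_hasFinDim.Build R (splitquat R) sq_vect_iso.
HB.instance Definition _ := Algebra_isFalgebra.Build R (splitquat R).

Definition sqI : splitquat R := SplitQuat 0 1 0 0.
Definition sqJ : splitquat R := SplitQuat 0 0 1 0.
Definition sqK : splitquat R := SplitQuat 0 0 0 1.

Lemma splitquat_relations :
  [/\ sqI * sqI = -1, sqJ * sqJ = 1, sqK * sqK = 1 & sqI * sqJ = sqK] /\
  [/\ sqJ * sqI = - (sqI * sqJ), sqK * sqI = - (sqI * sqK)
    & sqK * sqJ = - (sqJ * sqK)].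
Proof. by split; split; apply: sq_eq => /=; ring. Qed.

Definition sq_star u := SplitQuat (sq1 u) (- sqi u) (- sqj u) (- sqk u).

Definition sigma (t : R) : splitquat R := (1 - t) *: sqI + t *: sqJ.

Definition Kspace (t : R) : {vspace splitquat R} := (<[1]> + <[sigma t]>)%VS.

Lemma KspaceP t u :
  reflect (exists a b : R, u = a%:A + b *: sigma t) (u \in Kspace t).
Proof.
apply: (iffP memv_addP) => [[_ /vlineP[a ->]] [_ /vlineP[b ->]] ->|[a [b ->]]].
  by exists a, b.
exists a%:A; first by apply/vlineP; exists a.
by exists (b *: sigma t) => //; apply/vlineP; exists b.
Qed.

Lemma Kspace1 t : 1 \in Kspace t.
Proof. by apply/KspaceP; exists 1, 0; rewrite scale1r scale0r addr0. Qed.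

Lemma sigma_sqr t : sigma t * sigma t = (2 * t - 1)%:A.
Proof. by apply: sq_eq => /=; ring. Qed.

Lemma Kspace_is_aspace t : is_aspace (Kspace t).
Proof.
rewrite /is_aspace has_algid1 ?Kspace1 //=.
apply/prodvP => _ _ /KspaceP[a [b ->]] /KspaceP[c [d ->]]; apply/KspaceP.
exists (a * c + b * d * (2 * t - 1)), (a * d + b * c).
by apply: sq_eq => /=; ring.
Qed.

Definition Kalg (t : R) : {aspace splitquat R} := ASpace (Kspace_is_aspace t).

Lemma Kspace_star t u : u \in Kspace t -> sq_star u \in Kspace t.
Proof.
move=> /KspaceP[a [b ->]]; apply/KspaceP; exists a, (- b).
by apply: sq_eq => /=; ring.
Qed.

End SplitQuaternions.

Notation KK t := (subvs_of (Kalg t)).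

Definition K_star {R : realType} (t : R) (z : KK t) : KK t :=
  Subvs (Kspace_star (valP z) : _ \in (Kalg t : {vspace _})).

Lemma vsval_K1 {R : realType} (t : R) : vsval (1 : KK t) = 1.
Proof. by have := Kspace1 t; rewrite -[_ \in _]/(1 \in Kalg t) -algid_eq1 => /eqP. Qed.

(* The involution x |-> -x of R[x]/(h), for h with h(-x) = h(x). *)
Definition qpoly_star {R : realType} (h : {poly R}) (q : {poly %/ h}) : {poly %/ h} :=
  in_qpoly h ((q : {poly R}) \Po (- 'X)).

Notation dual_numbers R := {poly %/ ('X^2 : {poly R})}.
Notation split_complex R := {poly %/ ('X^2 - 1 : {poly R})}.

Definition star_isomorphic {R : realType} (A B : lalgType R)
    (starA : A -> A) (starB : B -> B) : Prop :=
  exists f : {lrmorphism A -> B},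
    bijective f /\ forall x, f (starA x) = starB (f x).

(* C^k and smooth functions on an open set of a normed space; in finite
   dimension the recursion amounts to continuity of all partial derivatives. *)
Fixpoint Ck {R : realType} {V : normedModType R} (k : nat) (U : set V) (f : V -> R^o) : Prop :=
  if k is k'.+1 then
    (forall x, U x -> differentiable f x) /\ forall v, Ck k' U ('D_v f)
  else forall x, U x -> {for x, continuous f}.

Definition smooth_on {R : realType} {V : normedModType R} (U : set V) (f : V -> R^o) : Prop :=
  forall k, Ck k U f.

Section ProjectiveSpace.
Context {R : realType} (F : falgType R) (n : nat).

Definition good (u : 'rV[F]_n.+1) : Prop :=
  forall a : F, exists v : 'I_n.+1 -> F, \sum_i u 0 i * v i = a.

Definition goodvec : Type := {u : 'rV[F]_n.+1 | `[< good u >]}.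
HB.instance Definition _ := SubChoice.on goodvec.

(* Real coordinates on F^(n+1) in a basis of F, and the inverse map. *)
Definition coords (u : 'rV[F]_n.+1) : 'M[R]_(n.+1, \dim {:F}) :=
  \matrix_(i, j) coord (vbasis {:F}) j (u 0 i).
Definition of_coords (M : 'M[R]_(n.+1, \dim {:F})) : 'rV[F]_n.+1 :=
  \row_i \sum_j M i j *: (vbasis {:F})`_j.

HB.instance Definition _ := Topological.copy goodvec
  (initial_topology (fun u : goodvec => coords (val u))).

Definition proportional (u v : goodvec) : bool :=
  `[< exists2 a : F, a \is a GRing.unit & val v = a *: val u >].

Lemma proportional_refl : reflexive proportional.
Proof. by move=> u; apply/asboolP; exists 1; rewrite ?unitr1 ?scale1r. Qed.
Lemma proportional_sym : symmetric proportional.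
Proof.
suff imp u v : proportional u v -> proportional v u by move=> u v; apply/idP/idP; exact: imp.
move=> /asboolP[a Ua E]; apply/asboolP; exists a^-1; first by rewrite unitrV.
by rewrite E scalerA mulVr // scale1r.
Qed.
Lemma proportional_trans : transitive proportional.
Proof.
move=> v u w /asboolP[a Ua Ea] /asboolP[b Ub Eb]; apply/asboolP.
by exists (b * a); rewrite ?unitrMl // Eb Ea scalerA.
Qed.
Canonical proportional_equiv :=
  EquivRel proportional proportional_refl proportional_sym proportional_trans.

Definition projspace : Type := quotient_topology {eq_quot proportional_equiv}.
HB.instance Definition _ := Quotient.on projspace.
HB.instance Definition _ := Topological.on projspace.

Definition projpt (u : goodvec) : projspace := \pi_projspace u.

(* The manifold structure on projspace is the one making projpt a submersion,
   so a function is smooth near x exactly when its pullback by projpt is smooth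
   on the corresponding open cone of good vectors. cone_fun h is that pullback
   in coordinates, extended by 0 to vectors which are not good. *)
Definition cone_fun (h : projspace -> R) (M : 'M[R]_(n.+1, \dim {:F})) : R :=
  oapp (fun u : goodvec => h (projpt u)) 0 (insub (of_coords M)).

Definition smooth_near (x : projspace) (h : projspace -> R) : Prop :=
  exists U : set projspace, [/\ open U, U x
    & smooth_on [set coords (val u) | u in projpt @^-1` U] (cone_fun h)].

End ProjectiveSpace.

Definition smooth_near_line {R : realType} (s : R) (h : R -> R) : Prop :=
  exists U : set R^o, [/\ open U, U s & smooth_on U (h : R^o -> R^o)].

(* Below, a smooth structure on T is given by the predicate smT y h: the real
   function h is smooth near the point y of T. *)
Definition smooth_map_at {R : realType} {S T : topologicalType}
    (smS : S -> (S -> R) -> Prop) (smT : T -> (T -> R) -> Prop) (f : S -> T) (x : S) : Prop :=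
  {for x, continuous f} /\ forall h : T -> R, smT (f x) h -> smS x (h \o f).

Definition smooth_curve {R : realType} {T : topologicalType}
    (smT : T -> (T -> R) -> Prop) (c : R -> T) : Prop :=
  \forall s \near (0 : R), smooth_map_at smooth_near_line smT c s.

(* Tangent vectors are velocities at 0 of smooth curves: this is equality of
   the tangent vectors represented by c1 and c2. *)
Definition same_velocity {R : realType} {T : topologicalType}
    (smT : T -> (T -> R) -> Prop) (c1 c2 : R -> T) : Prop :=
  c1 0 = c2 0 /\ forall h : T -> R, smT (c1 0) h ->
    derive1 (h \o c1 : R -> R^o) 0 = derive1 (h \o c2 : R -> R^o) 0.

Definition immersion {R : realType} {S T : topologicalType}
    (smS : S -> (S -> R) -> Prop) (smT : T -> (T -> R) -> Prop) (f : S -> T) : Prop :=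
  (forall x, smooth_map_at smS smT f x) /\
  forall c1 c2 : R -> S, smooth_curve smS c1 -> smooth_curve smS c2 -> c1 0 = c2 0 ->
    same_velocity smT (f \o c1) (f \o c2) -> same_velocity smS c1 c2.

Definition topological_embedding {S T : topologicalType} (f : S -> T) : Prop :=
  [/\ continuous f, injective f &
      forall U : set S, open U -> exists2 V : set T, open V & f @^-1` V = U].

Definition smooth_embedding {R : realType} {S T : topologicalType}
    (smS : S -> (S -> R) -> Prop) (smT : T -> (T -> R) -> Prop) (f : S -> T) : Prop :=
  topological_embedding f /\ immersion smS smT f.

Section Metric.
Context {R : realType} (F : falgType R) (star : F -> F).

Definition herm (u v : 'rV[F]_2) : F := u 0 0 * star (v 0 0) + u 0 1 * star (v 0 1).

Definition regular : set (projspace F 1) :=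
  [set x | exists2 p : goodvec F 1, x = projpt p & herm (val p) (val p) != 0].

(* F-linear maps from the line F p to its orthogonal; only the values of phi on
   F p matter. *)
Definition tangent_map (p : 'rV[F]_2) (phi : 'rV[F]_2 -> 'rV[F]_2) : Prop :=
  let line := [set u | exists a : F, u = a *: p] in
  (forall (a : F) u v, line u -> line v -> phi (a *: u + v) = a *: phi u + phi v) /\
  (forall u, line u -> herm (phi u) p = 0).

(* The curve e |-> [p + e phi(p)]; insubd gives [p] when the vector is not
   good, which does not happen for e near 0. *)
Definition tangent_curve (p : goodvec F 1) (phi : 'rV[F]_2 -> 'rV[F]_2) (e : R) :
    projspace F 1 :=
  projpt (insubd p (val p + (e%:A : F) *: phi (val p))).

(* An element of F lying on the real line; see RepartE and vsval_Repart. *)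
Definition Repart (u : F) : F := 2^-1 *: (u + star u).

Definition metric (p : 'rV[F]_2) (phi psi : 'rV[F]_2 -> 'rV[F]_2) : F :=
  Repart (herm (phi p) (psi p) / herm p p).

End Metric.

Lemma RepartE {R : realType} (u : splitquat R) : Repart sq_star u = (sq1 u)%:A.
Proof. by apply: sq_eq => /=; field. Qed.

Lemma vsval_Repart {R : realType} (t : R) (u : KK t) :
  vsval (Repart (@K_star R t) u) = (sq1 (vsval u))%:A.
Proof. by rewrite -RepartE. Qed.

Section Embedding.
Context {R : realType} (t : R) (n : nat).

Definition K_incl (u : 'rV[KK t]_n.+1) : 'rV[splitquat R]_n.+1 := map_mx vsval u.

Lemma good_incl (u : goodvec (KK t) n) : `[< good (K_incl (val u)) >].
Proof.
case: u => u /= /asboolP/(_ 1)[v uv]; apply/asboolP => a.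
exists (fun i => vsval (v i) * a).
rewrite -[RHS]mul1r -(vsval_K1 t) -uv linear_sum mulr_suml.
by apply: eq_bigr => i _; rewrite mxE mulrA.
Qed.

Definition good_emb (u : goodvec (KK t) n) : goodvec (splitquat R) n :=
  exist _ (K_incl (val u)) (good_incl u).

(* [z_0 : ... : z_n] |-> [z_0 : ... : z_n] on a chosen representative; that any
   representative gives the same point is part of the theorem. *)
Definition proj_emb (x : projspace (KK t) n) : projspace (splitquat R) n :=
  projpt (good_emb (repr x)).

End Embedding.

(* pushes phi phi' says that the differential of f at [p] maps the tangent
   vector phi to phi'; q is any representative of f [p]. Both metric values are
   real, and compared in the split-quaternions. *)
Definition isometric_on_regular {R : realType} (t : R)
    (f : projspace (KK t) 1 -> projspace (splitquat R) 1) : Prop :=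
  forall p : goodvec (KK t) 1, regular (@K_star R t) (projpt p) ->
    regular sq_star (f (projpt p)) /\
    forall q : goodvec (splitquat R) 1, projpt q = f (projpt p) ->
      let pushes phi phi' := same_velocity (@smooth_near R (splitquat R) 1)
        (f \o tangent_curve p phi) (tangent_curve q phi') in
      (forall phi, tangent_map (@K_star R t) (val p) phi ->
         exists2 phi', tangent_map sq_star (val q) phi' & pushes phi phi') /\
      (forall phi psi phi' psi',
         tangent_map (@K_star R t) (val p) phi -> tangent_map (@K_star R t) (val p) psi ->
         tangent_map sq_star (val q) phi' -> tangent_map sq_star (val q) psi' ->
         pushes phi phi' -> pushes psi psi' ->
         metric sq_star (val q) phi' psi' = vsval (metric (@K_star R t) (val p) phi psi)).

(* Main.v *)
Require Import Defs.
From HB Require Import structures.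
From mathcomp Require Import all_boot all_order all_algebra.
From mathcomp Require Import falgebra complex ring lra.
From mathcomp Require Import all_classical all_reals all_analysis.

Set Implicit Arguments.
Unset Strict Implicit.
Unset Printing Implicit Defensive.

Import Order.TTheory GRing.Theory Num.Theory.
Import numFieldNormedType.Exports.

Local Open Scope classical_set_scope.
Local Open Scope ring_scope.
Local Open Scope quotient_scope.

(** Write H for the split-quaternions and K for the subalgebra R + R sigma(t).

    The algebra K is generated by sigma(t), with square 2t - 1, so it is isomorphic
    to any algebra with real basis 1, tau such that tau^2 = 2t - 1: take for tau a
    real multiple of i in the complex numbers, or of the class of x in R[x]/(x^2)
    or R[x]/(x^2 - 1), according to the sign of 2t - 1
    ([generator_star_isomorphic]).

    Everything about projective spaces rests on affine charts.  A weight w defines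
    the functional u |-> u.w, the sum of the u_i w_i.  Where u.w is invertible, the
    vector (u.w)^-1 u depends only on the point [u], and is a rational function of
    u because an inverse in H is the conjugate divided by the norm.  A function
    given by a smooth expression in (u.w)^-1 u is therefore smooth on the projective
    space over H ([smooth_near_normalized]).

    Embedding.  A vector u over K is good exactly when u.w is a unit for some weight
    w over K.  With such a w, the vector (u.w)^-1 u is the same over K and over H; on
    the projective space over H, a real-linear retraction of H onto K applied to it
    gives a smooth local left inverse of the embedding.  This left inverse shows that
    the topology of the source is induced ([topological_embedding_proj_emb]), and
    composition with it turns a smooth function on the source into a smooth function
    on the target, so that the target sees all the velocities of the source
    ([immersion_proj_emb]).  Injectivity is algebraic: if v = a u with u.w = 1, then
    a = v.w lies in K.

    Isometry.  A representative q of the image of [p] is a p for a unit a of H.  The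
    curve [p + e phi(p)] maps to [q + e a phi(p)], which is the curve of a tangent
    map at q.  In the chart of weight q^*, a curve [q + e v] with v orthogonal to q is
    the affine line <q,q>^-1 (q + e v), so its velocity determines v
    ([line_curve_inj]): every phi' to which phi is pushed satisfies
    phi'(q) = a phi(p).  The metrics agree because <q,q> = N(a) <p,p> and
    Re(a x a^* ) = N(a) Re(x), with N(a) = a a^* ([metric_incl]). *)

(** * Functions of class C^k *)
Section Calculus.
Context {R : realType}.

Lemma near_eq_differentiable (V W : normedModType R) (f g : V -> W) x :
  (\forall y \near x, f y = g y) -> differentiable f x -> differentiable g x.
Proof.
move=> fg df; have fgx := nbhs_singleton fg.
have /eqaddoP fo := diff_locally df.
have gE : g \o shift x = cst (g x) + 'd f x +o_ 0 id.
  apply/eqaddoP => e e0; have := fo e e0; apply: filter_app.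
  have : \forall h \near (0 : V), f (h + x) = g (h + x).
    by move: fg; rewrite (near_shift 0) /= subr0.
  by apply: filter_app; near=> h => /= fgh; rewrite /= !fctE /= fgh fgx.
have dg : 'd g x = 'd f x :> (V -> W) by apply: diff_unique gE; exact: diff_continuous.
by apply/diff_locallyP; rewrite dg; split => //; exact: diff_continuous.
Unshelve. all: by end_near. Qed.

Context {V : normedModType R}.
Implicit Types (U : set V) (f g : V -> R^o).

(** Openness of U matters: the derivatives at a point of U depend on the values of
    the function in a neighbourhood. *)
Lemma eq_Ck k U f g : open U -> (forall x, U x -> f x = g x) -> Ck k U f -> Ck k U g.
Proof.
move=> oU; have nearE (h h' : V -> R^o) x :
    (forall y, U y -> h y = h' y) -> U x -> \forall y \near x, h y = h' y.
  by move=> hh Ux; apply: filterS hh _; exact: open_nbhs_nbhs.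
elim: k f g => [|k IH] f g fg /=.
  move=> cf x Ux; rewrite /prop_for /continuous_at -(fg x Ux).
  by apply: cvg_trans (cf x Ux); apply: near_eq_cvg; exact: nearE Ux.
move=> [df Df]; split=> [x Ux|v]; first exact: near_eq_differentiable (nearE _ _ _ fg Ux) (df _ Ux).
by apply: IH (Df v) => x Ux; apply: near_eq_derive; exact: nearE.
Qed.

Lemma CkS k U f : Ck k.+1 U f -> Ck k U f.
Proof.
elim: k f => [|k IH] f [df Df]; first by move=> x /df/differentiable_continuous.
by split=> // v; exact/IH/Df.
Qed.

Lemma Ck_cst k U (a : R) : Ck k U (cst a).
Proof.
elim: k a => [|k IH] a /=; first by move=> x _; exact: cst_continuous.
split=> [x _|v]; first exact: differentiable_cst.
rewrite (_ : 'D_v (cst a) = cst 0); first exact: IH.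
by apply/funext => x; rewrite derive_cst.
Qed.

Lemma CkD k U f g : open U -> Ck k U f -> Ck k U g -> Ck k U (fun x => f x + g x).
Proof.
move=> oU; elim: k f g => [|k IH] f g /=.
  by move=> cf cg x Ux; apply: cvgD; [exact: cf|exact: cg].
move=> [df Df] [dg Dg]; split=> [x Ux|v]; first by apply: differentiableD; auto.
apply: eq_Ck (IH _ _ (Df v) (Dg v)) => // x Ux /=.
by rewrite -deriveD//; apply: diff_derivable; auto.
Qed.

Lemma CkM k U f g : open U -> Ck k U f -> Ck k U g -> Ck k U (fun x => f x * g x).
Proof.
move=> oU; elim: k f g => [|k IH] f g.
  by move=> cf cg x Ux; apply: cvgM; [exact: cf|exact: cg].
move=> Cf Cg; have [[df Df] [dg Dg]] := (Cf, Cg).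
split=> [x Ux|v]; first by apply: differentiableM; auto.
have := CkD oU (IH _ _ (CkS Cf) (Dg v)) (IH _ _ (CkS Cg) (Df v)).
apply: eq_Ck => // x Ux /=.
by rewrite (deriveM (f := f) (g := g))//; apply: diff_derivable; auto.
Qed.

Lemma CkV k U f : open U -> (forall x, U x -> f x != 0) -> Ck k U f -> Ck k U (fun x => (f x)^-1).
Proof.
move=> oU f0; elim: k => [|k IH].
  by move=> cf x Ux; apply: cvgV; [exact: f0|exact: cf].
move=> Cf; have [df Df] := Cf.
split=> [x Ux|v]; first by apply: differentiableV; auto.
have IHf := IH (CkS Cf).
have := CkM oU (CkM oU (Ck_cst k U (-1)) (CkM oU IHf IHf)) (Df v).
apply: eq_Ck => // x Ux /=.
rewrite deriveV; [|exact: f0|by apply: diff_derivable; auto].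
by rewrite /GRing.scale /= mulN1r expr2 invfM.
Qed.

Lemma Ck_sum k U (I : Type) (r : seq I) (F : I -> V -> R^o) :
  open U -> (forall i, Ck k U (F i)) -> Ck k U (fun x => \sum_(i <- r) F i x).
Proof.
move=> oU CF; elim: r => [|i r IH].
  by apply: eq_Ck (Ck_cst k U 0) => // x _; rewrite big_nil.
by apply: eq_Ck (CkD oU (CF i) IH) => // x _; rewrite big_cons.
Qed.

Lemma continuous_sumZ (W : normedModType R) (I : finType) (e : I -> W) (G : I -> V -> R^o) x :
  (forall i, {for x, continuous (G i)}) -> {for x, continuous (fun x => \sum_i G i x *: e i)}.
Proof.
move=> cG; apply: cvg_big => [|i _]; first exact: add_continuous.
by apply: cvgZ; [exact: cG|exact: cvg_cst].
Qed.

(** Each directional derivative of h o G is the sum over i of D_v(G_i) times the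
    composite of D_(e_i) h with G.  Those composites have the shape of the lemma with
    one derivative less on h, so that induction on k applies. *)
Lemma Ck_comp k (W : normedModType R) (I : finType) (e : I -> W) (G : I -> V -> R^o)
    U (U' : set W) (h : W -> R^o) : open U ->
  (forall x, U x -> U' (\sum_i G i x *: e i)) ->
  (forall i, Ck k U (G i)) -> Ck k U' h -> Ck k U (fun x => h (\sum_i G i x *: e i)).
Proof.
move=> oU GU; elim: k h => [|k IH] h CG Ch.
  move=> x Ux; apply: (@continuous_comp _ _ _ (fun x => \sum_i G i x *: e i) h); last exact/Ch/GU.
  by apply: continuous_sumZ => i; exact: CG.
pose S x := \sum_i G i x *: e i.
have SE : S = \sum_i (fun x => G i x *: e i).
  by apply/funext => y; rewrite fct_sumE.
have dG i x : U x -> differentiable (G i) x by case: (CG i); auto.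
have dGe i x : U x -> differentiable (fun x => G i x *: e i) x.
  by move=> Ux; apply: differentiableZl; exact: dG.
have dS x : U x -> differentiable S x.
  move=> Ux; rewrite SE; elim/big_ind: _ => [|f g df dg|i _]; last exact: dGe.
    exact: differentiable_cst.
  exact: differentiableD.
have DS x v : U x -> 'D_v S x = \sum_i 'D_v (G i) x *: e i.
  move=> Ux; rewrite SE.
  suff dv : is_derive x v (\sum_i (fun x => G i x *: e i)) (\sum_i 'D_v (G i) x *: e i).
    exact: derive_val.
  elim/big_ind2: _ => [|f ? g ? ? ?|i _]; [exact: is_derive_cst|exact: is_deriveD|].
  apply: DeriveDef; first by apply: diff_derivable; exact: dGe.
  rewrite !deriveE; [|exact: dG|exact: dGe].
  by rewrite diffZl //; exact: dG.
have [dh Dh] := Ch.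
have dhS x : U x -> differentiable h (S x) by move=> Ux; exact/dh/GU.
split=> [x Ux|v].
  by apply: (@differentiable_comp _ _ _ _ S h); [exact: dS|exact: dhS].
have Ct i : Ck k U (fun x => 'D_v (G i) x * 'D_(e i) h (S x)).
  apply: CkM => //; first by case: (CG i) => _; exact.
  exact: (IH ('D_(e i) h) (fun j => CkS (CG j)) (Dh (e i))).
apply: eq_Ck (Ck_sum (index_enum I) oU Ct) => // x Ux.
rewrite [RHS](deriveE _ (f := h \o S)); last first.
  by apply: differentiable_comp; [exact: dS|exact: dhS].
rewrite diff_comp; [|exact: dS|exact: dhS] => /=.
rewrite -(deriveE v (dS x Ux)) DS // linear_sum; apply: eq_bigr => i _.
by rewrite linearZ /= -(deriveE _ (dhS x Ux)).
Qed.

End Calculus.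

(** * Matrix spaces and vector-valued functions *)
Section MatrixSpaces.
Context {R : realType}.

Lemma linear_mx_continuous m p (W : normedModType R) (f : 'M[R]_(m, p) -> W) :
  linear f -> continuous f.
Proof.
move=> lf; pose lfM := GRing.isLinear.Build _ _ _ _ _ lf.
pose fL : {linear 'M[R]_(m, p) -> W} := HB.pack f lfM.
have fE M : f M = \sum_ij M ij.1 ij.2 *: fL (delta_mx ij.1 ij.2).
  rewrite -[LHS]/(fL M) {1}[M]matrix_sum_delta pair_big linear_sum.
  by apply: eq_bigr => ij _; rewrite linearZ.
rewrite (funext fE) => M.
pose G (ij : 'I_m * 'I_p) (N : 'M[R]_(m, p)) : R^o := N ij.1 ij.2.
have cG ij : {for M, continuous (G ij)} by exact: coord_continuous.
exact: continuous_sumZ cG.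
Qed.

Lemma Ck_linear k m p (U : set 'M[R]_(m, p)) (f : 'M[R]_(m, p) -> R^o) :
  linear f -> Ck k U f.
Proof.
move=> lf; have cf := linear_mx_continuous lf.
pose lfM := GRing.isLinear.Build _ _ _ _ _ lf.
pose fL : {linear 'M[R]_(m, p) -> R^o} := HB.pack f lfM.
have df x : differentiable f x by exact: (@linear_differentiable _ _ _ fL).
case: k => [|k] /=; first by move=> x _; exact: cf.
split=> // v; rewrite (_ : 'D_v f = cst (f v)); first exact: Ck_cst.
by apply/funext => x; rewrite deriveE // (@diff_lin _ _ _ fL).
Qed.

Lemma Ck_comp_mx k (V : normedModType R) m p U (U' : set 'M[R]_(m, p))
    (G : V -> 'M[R]_(m, p)) (h : 'M[R]_(m, p) -> R^o) :
  open U -> (forall x, U x -> U' (G x)) ->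
  (forall i j, Ck k U (fun x => G x i j : R^o)) -> Ck k U' h -> Ck k U (h \o G).
Proof.
move=> oU UU' CG Ch.
have GE x : G x = \sum_ij G x ij.1 ij.2 *: delta_mx ij.1 ij.2.
  by rewrite {1}[G x]matrix_sum_delta pair_big.
rewrite (_ : h \o G = fun x => h (\sum_ij G x ij.1 ij.2 *: delta_mx ij.1 ij.2)).
  by apply: (Ck_comp (G := fun ij x => G x ij.1 ij.2)) Ch => // x Ux; rewrite -GE; exact: UU'.
by apply/funext => x /=; rewrite -GE.
Qed.

End MatrixSpaces.

Section VectorValued.
Context {R : realType} {V : normedModType R}.

(** Quantifying over all linear functionals avoids a choice of basis, and makes
    composition with a linear map immediate. *)
Definition Ckvec (E : vectType R) k (U : set V) (f : V -> E) :=
  forall phi : E -> R^o, linear phi -> Ck k U (phi \o f).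

Lemma Ckvec_linear (E E' : vectType R) k U (f : V -> E) (phi : E -> E') :
  linear phi -> Ckvec k U f -> Ckvec k U (phi \o f).
Proof.
move=> lphi Cf psi lpsi; apply: (Cf (psi \o phi)) => a u v /=.
by rewrite lphi lpsi.
Qed.

Lemma CkvecD (E : vectType R) k U (f g : V -> E) : open U ->
  Ckvec k U f -> Ckvec k U g -> Ckvec k U (fun x => f x + g x).
Proof.
move=> oU Cf Cg phi lphi; apply: eq_Ck (CkD oU (Cf _ lphi) (Cg _ lphi)) => // x _ /=.
by rewrite -[f x in RHS]scale1r lphi scale1r.
Qed.

(** In a basis, every linear functional of a product is a bilinear expression in the
    coordinates of the two factors. *)
Lemma CkvecM (A : falgType R) k U (f g : V -> A) : open U ->
  Ckvec k U f -> Ckvec k U g -> Ckvec k U (fun x => f x * g x).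
Proof.
move=> oU Cf Cg phi lphi.
pose lphiM := GRing.isLinear.Build _ _ _ _ _ lphi.
pose phiL : {linear A -> R^o} := HB.pack phi lphiM.
pose e := vbasis {:A}.
have lc j : linear (coord e j : A -> R^o) by move=> a u v; rewrite linearP.
pose c i j : R^o := phi (e`_i * e`_j).
have C := fun ij => CkM oU (CkM oU (Cf _ (lc ij.1)) (Cg _ (lc ij.2))) (Ck_cst k U (c ij.1 ij.2)).
apply: eq_Ck (Ck_sum (index_enum _) oU C) => // x _ /=.
rewrite -(pair_bigA _ (fun i j => coord e i (f x) * coord e j (g x) * c i j)).
rewrite -[RHS]/(phiL _) {2}(coord_vbasis (memvf (f x))) {2}(coord_vbasis (memvf (g x))).
rewrite mulr_suml linear_sum; apply: eq_bigr => i _.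
rewrite mulr_sumr linear_sum; apply: eq_bigr => j _.
rewrite [X in phiL X](_ : _ = (coord e i (f x) * coord e j (g x)) *: (e`_i * e`_j)).
  by rewrite linearZ.
by rewrite -scalerAl -scalerAr scalerA.
Qed.

Lemma CkvecZ (E : vectType R) k U (s : V -> R^o) (f : V -> E) : open U ->
  Ck k U s -> Ckvec k U f -> Ckvec k U (fun x => s x *: f x).
Proof.
move=> oU Cs Cf phi lphi; apply: eq_Ck (CkM oU Cs (Cf _ lphi)) => // x _ /=.
have phi0 : phi 0 = 0.
  by have := lphi 1 0 0; rewrite !scale1r addr0 -{1}[phi 0]addr0 => /addrI.
by rewrite -[s x *: _]addr0 lphi phi0 addr0.
Qed.

Lemma Ckvec_cst (E : vectType R) k U (a : E) : Ckvec k U (cst a).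
Proof. by move=> phi _; exact: (Ck_cst k U (phi a)). Qed.

Lemma Ckvec_sum (E : vectType R) k U (I : Type) (r : seq I) (f : I -> V -> E) : open U ->
  (forall i, Ckvec k U (f i)) -> Ckvec k U (fun x => \sum_(i <- r) f i x).
Proof.
move=> oU Cf; elim: r => [|i r IH].
  by rewrite (_ : (fun x => _) = cst 0); [exact: Ckvec_cst|apply/funext => x; rewrite big_nil].
rewrite (_ : (fun x => _) = fun x => f i x + \sum_(j <- r) f j x); first exact: CkvecD.
by apply/funext => x; rewrite big_cons.
Qed.

End VectorValued.

(** * Projective spaces and cones of good vectors *)
Section Cone.
Context {R : realType} (F : falgType R) (n : nat).
Implicit Types (u v : goodvec F n) (U : set (projspace F n)) (h : projspace F n -> R).

Lemma coordsK : cancel (@coords R F n) (@of_coords R F n).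
Proof.
move=> u; apply/rowP => i; rewrite mxE [RHS](coord_vbasis (memvf (u 0 i))).
by apply: eq_bigr => j _; rewrite mxE.
Qed.

Lemma of_coordsK : cancel (@of_coords R F n) (@coords R F n).
Proof.
move=> M; apply/matrixP => i j; rewrite !mxE.
by rewrite coord_sum_free // (basis_free (vbasisP _)).
Qed.

Lemma coords_line (u0 v0 : 'rV[F]_n.+1) (e : R) :
  coords (u0 + (e%:A : F) *: v0) = @coords R F n u0 + e *: coords v0.
Proof. by apply/matrixP => i j; rewrite !mxE mulr_algl linearD linearZ. Qed.

Lemma of_coords_linear i : linear (fun M => @of_coords R F n M 0 i).
Proof.
move=> a M N; rewrite !mxE scaler_sumr -big_split.
by apply: eq_bigr => j _; rewrite !mxE scalerDl scalerA.
Qed.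

Lemma projptP u v :
  projpt u = projpt v <-> exists2 a : F, a \is a GRing.unit & val v = a *: val u.
Proof. by split=> [/eqquotP/asboolP//|E]; apply/eqquotP/asboolP. Qed.

Lemma projpt_repr (x : projspace F n) : projpt (repr x) = x.
Proof. exact: reprK. Qed.

Lemma cone_fun_coords h u : cone_fun h (coords (val u)) = h (projpt u).
Proof. by rewrite /cone_fun coordsK valK. Qed.

Lemma continuous_coords : continuous (fun u => coords (val u)).
Proof. exact: initial_continuous. Qed.

Lemma continuous_projpt : continuous (@projpt R F n).
Proof. exact: pi_continuous. Qed.

(** The set of real coordinate vectors on which smoothness of a function on U is
    tested. *)
Definition cone U := [set coords (val u) | u in @projpt R F n @^-1` U].

Lemma coneE u U : cone U (coords (val u)) <-> U (projpt u).
Proof.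
split=> [[v Uv]|Uu]; last by exists u.
by move=> /(can_inj coordsK)/val_inj <-.
Qed.

Lemma coneP U M : cone U M <-> exists v : goodvec F n, M = coords (val v) /\ U (projpt v).
Proof.
by split=> [[v Uv <-]|[v [-> Uv]]]; exists v.
Qed.

(** The topology of the projective space is a quotient of an initial topology, so
    an open set is described by an open set of coordinates. *)
Lemma open_projspace U : open U <->
  exists2 A : set 'M[R]_(n.+1, \dim {:F}), open A & forall u, U (projpt u) <-> A (coords (val u)).
Proof.
split=> [[A oA AU]|[A oA AU]]; exists A => //.
  by move=> u; rewrite -[A _]/(((fun v => coords (val v)) @^-1` A) u) AU.
by apply/funext => u; apply/propext; split=> /AU.
Qed.

Definition dot (w : 'I_n.+1 -> F) (u : 'rV[F]_n.+1) : F := \sum_i u 0 i * w i.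

Lemma dotZ w (a : F) (u : 'rV[F]_n.+1) : dot w (a *: u) = a * dot w u.
Proof. by rewrite mulr_sumr; apply: eq_bigr => i _; rewrite mxE mulrA. Qed.

Lemma good_dot (w : 'I_n.+1 -> F) (u : 'rV[F]_n.+1) :
  dot w u \is a GRing.unit -> good u.
Proof.
move=> Uw a; exists (fun i => w i * ((dot w u)^-1 * a)).
rewrite -[RHS](mulVKr Uw) mulr_suml; apply: eq_bigr => i _.
by rewrite mulrA.
Qed.

Lemma Ckvec_dot k (D : set 'M[R]_(n.+1, \dim {:F})) (w : 'I_n.+1 -> F) : open D ->
  Ckvec k D (fun M => dot w (@of_coords R F n M)).
Proof.
move=> oU; apply: Ckvec_sum => // i; apply: CkvecM => //; last exact: Ckvec_cst.
move=> phi lphi; apply: Ck_linear => a M N /=.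
by rewrite of_coords_linear lphi.
Qed.

(** For an algebra whose units are detected by a form a |-> N(a a^* ), the unit
    condition on u.w is a polynomial inequality in the coordinates of u. *)
Section OpenGood.
Variables (N : F -> R^o) (star : F -> F).
Hypotheses (lN : linear N) (lstar : linear star).
Hypothesis unitN : forall a : F, a \is a GRing.unit <-> N (a * star a) != 0.

Lemma open_unit_dot (w : 'I_n.+1 -> F) :
  open [set M | dot w (of_coords M) \is a GRing.unit].
Proof.
have oT : open [set: 'M[R]_(n.+1, \dim {:F})] by exact: openT.
have cd := Ckvec_dot 0 w oT.
pose f M : R^o := N (dot w (of_coords M) * star (dot w (of_coords M))).
have cf : continuous f by move=> M; apply: (CkvecM oT cd (Ckvec_linear lstar cd) lN).
rewrite (_ : [set M | _] = f @^-1` [set x | x != 0]).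
  by apply: open_comp => [M _|]; [exact: cf|exact: open_neq].
by apply/funext => M; apply/propext; exact: unitN.
Qed.

(** A vector is good exactly when u.w is a unit for some weight w: if u is good, some
    w gives u.w = 1. *)
Lemma open_good : open [set coords (val u) | u in @setT (goodvec F n)].
Proof.
rewrite (_ : [set _ | u in _] = \bigcup_w [set M | dot w (of_coords M) \is a GRing.unit]).
  by apply: bigcup_open => w _; exact: open_unit_dot.
apply/seteqP; split=> [_ [u _ <-]|M [w _ Uw]].
  have /asboolP/(_ 1)[w uw] := valP u; exists w => //=.
  by rewrite coordsK /dot uw unitr1.
by exists (exist _ (of_coords M) (asboolT (good_dot Uw))) => //=; rewrite of_coordsK.
Qed.

Lemma open_cone U : open U -> open (cone U).
Proof.
move=> /open_projspace[A oA UA].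
rewrite (_ : cone U = A `&` [set coords (val u) | u in @setT (goodvec F n)]).
  by apply: openI => //; exact: open_good.
apply/seteqP; split=> [_ [u Uu <-]|_ [/[swap] [[u _ <-]] /UA Uu]].
  by split; [exact/UA|exists u].
exact/coneE.
Qed.

End OpenGood.

End Cone.

(** * Units of the split-quaternions and affine charts *)
Section SplitQuaternionUnits.
Context {R : realType}.
Implicit Types u v : splitquat R.

Definition sq_norm u : R := sq1 (u * sq_star u).

Lemma sq_mulstar u : u * sq_star u = (sq_norm u)%:A.
Proof. by rewrite /sq_norm; apply: sq_eq => /=; ring. Qed.

Lemma sq_starmul u : sq_star u * u = (sq_norm u)%:A.
Proof. by rewrite /sq_norm; apply: sq_eq => /=; ring. Qed.

Lemma sq_normM u v : sq_norm (u * v) = sq_norm u * sq_norm v.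
Proof. by rewrite /sq_norm /=; ring. Qed.

Lemma sq_starM u v : sq_star (u * v) = sq_star v * sq_star u.
Proof. by apply: sq_eq => /=; ring. Qed.

Lemma sq_norm1 : sq_norm 1 = 1.
Proof. by rewrite /sq_norm /=; ring. Qed.

Lemma sq_star_linear : linear (@sq_star R).
Proof. by move=> a u v; apply: sq_eq => /=; ring. Qed.

Lemma sq1_linear : linear (@sq1 R : splitquat R -> R^o).
Proof. by []. Qed.

Lemma sq_unitP u : u \is a GRing.unit <-> sq_norm u != 0.
Proof.
split=> [Uu|Nu].
  apply/eqP => N0; have /eqP : sq_norm (u * u^-1) = 0 by rewrite sq_normM N0 mul0r.
  by rewrite mulrV // sq_norm1 oner_eq0.
apply/unitrP; exists ((sq_norm u)^-1 *: sq_star u).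
by rewrite -scalerAl -scalerAr sq_starmul sq_mulstar scalerA mulVf // scale1r.
Qed.

Lemma sq_inv u : u \is a GRing.unit -> u^-1 = (sq_norm u)^-1 *: sq_star u.
Proof.
move=> Uu; apply: (mulrI Uu); rewrite mulrV // -scalerAr sq_mulstar scalerA.
by rewrite mulVf ?scale1r //; exact/sq_unitP.
Qed.

End SplitQuaternionUnits.

Section Normalization.
Context {R : realType} (n : nat).
Local Notation H := (splitquat R).
Implicit Types (w : 'I_n.+1 -> H) (u v : goodvec H n).
Local Notation Mat := 'M[R]_(n.+1, \dim {:H}).
Implicit Types (h : projspace H n -> R) (A : set Mat).

(** The representative of [u] on the affine hyperplane of equation u.w = 1. *)
Definition normalize w (u : 'rV[H]_n.+1) : 'rV[H]_n.+1 := (dot w u)^-1 *: u.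

Lemma normalizeZ w (a : H) (u : 'rV[H]_n.+1) : a \is a GRing.unit ->
  dot w u \is a GRing.unit -> normalize w (a *: u) = normalize w u.
Proof. by move=> Ua Uu; rewrite /normalize dotZ invrM // scalerA -mulrA mulVr // mulr1. Qed.

Definition chart w A : set Mat :=
  [set M | dot w (of_coords M) \is a GRing.unit /\ A (coords (normalize w (of_coords M)))].

Definition proj_chart w A : set (projspace H n) :=
  [set x | exists u, x = projpt u /\ chart w A (coords (val u))].

Lemma proj_chartP w A u : proj_chart w A (projpt u) <-> chart w A (coords (val u)).
Proof.
split=> [[v [/esym/projptP[a Ua ->]]]|]; last by exists u.
rewrite /chart /= !coordsK dotZ => -[Uv Av].
by rewrite unitrMl // normalizeZ.
Qed.

(** With d = u.w, the i-th entry is N(d)^-1 d^* u_i, a rational function whose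
    denominator does not vanish. *)
Lemma Ckvec_normalize k w (D : set Mat) i : open D ->
  (forall M, D M -> dot w (of_coords M) \is a GRing.unit) ->
  Ckvec k D (fun M => normalize w (of_coords M) 0 i).
Proof.
move=> oD UD.
have Cd := @Ckvec_dot R H n k D w oD.
have Cs := Ckvec_linear (@sq_star_linear R) Cd.
have CN := CkvecM oD Cd Cs sq1_linear.
have Ci : Ckvec k D (fun M => @of_coords R H n M 0 i).
  by move=> phi lphi; apply: Ck_linear => a M N /=; rewrite of_coords_linear lphi.
have N0 M : D M -> sq_norm (dot w (of_coords M)) != 0 by move=> /UD/sq_unitP.
move=> phi lphi.
have := CkvecZ oD (CkV oD N0 CN) (CkvecM oD Cs Ci) lphi.
apply: eq_Ck => // M DM /=; congr phi; rewrite /normalize [in RHS]mxE sq_inv ?UD //.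
by rewrite -scalerAl.
Qed.

Lemma open_chart w A : open A -> open (chart w A).
Proof.
move=> oA; pose D := [set M | dot w (@of_coords R H n M) \is a GRing.unit].
have oD : open D by exact: (open_unit_dot sq1_linear sq_star_linear sq_unitP).
pose G M := coords (normalize w (@of_coords R H n M)).
rewrite openE => M [DM AM]; rewrite /interior.
have cG : {for M, continuous G}.
  have GE N : G N = \sum_ij G N ij.1 ij.2 *: delta_mx ij.1 ij.2.
    by rewrite {1}[G N]matrix_sum_delta pair_big.
  rewrite (funext GE).
  apply: (@continuous_sumZ _ _ _ _ _ (fun ij N => G N ij.1 ij.2)) => -[i j].
  have lc : linear (coord (vbasis {:H}) j : H -> R^o) by move=> a x y; rewrite linearP.
  have := Ckvec_normalize 0 i oD (fun M => id) lc.
  rewrite (_ : _ \o _ = fun N => G N i j); first by move=> /(_ M DM).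
  by apply/funext => N; rewrite [RHS]mxE.
near=> N; split; near: N; first exact: open_nbhs_nbhs.
by apply: cG; exact: open_nbhs_nbhs.
Unshelve. all: by end_near. Qed.

Lemma open_proj_chart w A : open A -> open (proj_chart w A).
Proof.
move=> oA; apply/open_projspace; exists (chart w A); first exact: open_chart.
by move=> u; exact: proj_chartP.
Qed.

(** The source of all smooth functions on the projective space over H used below:
    on the cone of the chart, the pullback of h is g composed with the rational map
    u |-> (u.w)^-1 u. *)
Lemma smooth_near_normalized w A (g : Mat -> R^o) h : open A -> smooth_on A g ->
  (forall v, chart w A (coords (val v)) ->
     h (projpt v) = g (coords (normalize w (val v)))) ->
  forall u, chart w A (coords (val u)) -> smooth_near (projpt u) h.
Proof.
move=> oA sg hg u Au; exists (proj_chart w A); split; first exact: open_proj_chart.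
  exact/proj_chartP.
have -> : [set coords (val u) | u in @projpt R H n @^-1` proj_chart w A] = chart w A.
  apply/seteqP; split=> [_ [v /proj_chartP Av <-] //|M AM].
  have [UM _] := AM.
  exists (exist _ (of_coords M) (asboolT (good_dot UM))); last by rewrite /= of_coordsK.
  by apply/proj_chartP; rewrite /= of_coordsK.
move=> k; have oC := open_chart (w := w) oA.
pose G M := coords (normalize w (@of_coords R H n M)).
have CG : Ck k (chart w A) (g \o G).
  apply: (Ck_comp_mx (U' := A)) => // [M [] //|i j].
  have lc : linear (coord (vbasis {:H}) j : H -> R^o) by move=> a x y; rewrite linearP.
  have := Ckvec_normalize k i oC (fun M (CM : chart w A M) => proj1 CM) lc.
  by apply: eq_Ck => // M _ /=; rewrite [RHS]mxE.
apply: eq_Ck CG => // M AM /=; have [UM _] := AM.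
pose v : goodvec H n := exist _ (of_coords M) (asboolT (good_dot UM)).
have Mv : M = coords (val v) by rewrite /= of_coordsK.
by rewrite Mv cone_fun_coords hg -?Mv // /G of_coordsK.
Qed.

End Normalization.

(** * The subalgebra K *)
Section Subalgebra.
Context {R : realType} (t : R).
Local Notation H := (splitquat R).
Local Notation K := (KK t).
Implicit Types (a b z : K) (u : H).

Lemma vsvalM a b : vsval (a * b) = vsval a * vsval b.
Proof. by []. Qed.

Definition K_norm a : R^o := sq1 (vsval a).

Lemma K_norm_linear : linear K_norm.
Proof. by move=> x a b; rewrite /K_norm linearP. Qed.

Lemma K_star_linear : linear (@K_star R t).
Proof. by move=> x a b; apply: val_inj; exact: (sq_star_linear x (vsval a) (vsval b)). Qed.

Lemma vsval_unit a : vsval a \is a GRing.unit <-> a \is a GRing.unit.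
Proof.
split=> [Ua|/unitrP[b [ba ab]]]; last first.
  by apply/unitrP; exists (vsval b); rewrite -!vsvalM ba ab vsval_K1.
apply/unitrP; exists ((sq_norm (vsval a))^-1 *: K_star a).
have N0 : sq_norm (vsval a) != 0 by exact/sq_unitP.
split; apply: val_inj; rewrite -[RHS]/(vsval 1) vsval_K1.
  rewrite -[LHS]/((_ *: sq_star (vsval a)) * vsval a) -scalerAl sq_starmul.
  by rewrite scalerA mulVf // scale1r.
rewrite -[LHS]/(vsval a * (_ *: sq_star (vsval a))) -scalerAr sq_mulstar.
by rewrite scalerA mulVf // scale1r.
Qed.

Lemma vsvalV a : a \is a GRing.unit -> vsval a^-1 = (vsval a)^-1.
Proof.
move=> Ua; have Uva : vsval a \is a GRing.unit by exact/vsval_unit.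
by apply: (mulrI Uva); rewrite -vsvalM !mulrV // vsval_K1.
Qed.

Lemma K_unitP a : a \is a GRing.unit <-> K_norm (a * K_star a) != 0.
Proof. by rewrite -vsval_unit sq_unitP. Qed.

(** A real-linear retraction of H onto K: for u = a + b sigma(t) the components of
    u along i and j are (1 - t) b and t b, so that their sum is b. *)
Definition retraction u : H := (sq1 u)%:A + (sqi u + sqj u) *: sigma t.

Definition K_retraction u : K := vsproj (Kalg t) (retraction u).

Lemma vsval_retraction u : vsval (K_retraction u) = retraction u.
Proof. by apply: vsprojK; apply/KspaceP; exists (sq1 u), (sqi u + sqj u). Qed.

Lemma K_retraction_linear : linear K_retraction.
Proof.
move=> x u v; apply: val_inj; rewrite linearP /= !vsval_retraction /retraction.
by apply: sq_eq => /=; ring.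
Qed.

Lemma retraction_vsval a : retraction (vsval a) = vsval a.
Proof.
by have /KspaceP[x [y ->]] := valP a; apply: sq_eq; rewrite /retraction /=; ring.
Qed.

Lemma K_retractionK a : K_retraction (vsval a) = a.
Proof. by apply: val_inj; rewrite /= vsval_retraction retraction_vsval. Qed.

End Subalgebra.

(** * The embedding of projective spaces *)
Section EntrywiseMaps.
Context {R : realType} (F G : falgType R) (n : nat).

Lemma coords_mapE (phi : F -> G) (u : 'rV[F]_n.+1) i j :
  coords (map_mx phi u) i j = coord (vbasis {:G}) j (phi (u 0 i)).
Proof. by rewrite !mxE. Qed.

Lemma coords_map_linear (phi : F -> G) : linear phi ->
  linear (fun M => coords (map_mx phi (@of_coords R F n M)) : 'M[R]_(n.+1, \dim {:G})).
Proof.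
move=> lphi a M N; apply/matrixP => i j; have /= ofc := of_coords_linear i a M N.
by rewrite [RHS]mxE [in RHS]mxE !coords_mapE ofc lphi linearP.
Qed.

Lemma Ck_coords_map k (phi : F -> G) (D : set 'M[R]_(n.+1, \dim {:F}))
    (A : set 'M[R]_(n.+1, \dim {:G})) (g : 'M[R]_(n.+1, \dim {:G}) -> R^o) :
  linear phi -> open D ->
  (forall M, D M -> A (coords (map_mx phi (@of_coords R F n M)))) ->
  Ck k A g -> Ck k D (fun M => g (coords (map_mx phi (@of_coords R F n M)))).
Proof.
move=> lphi oD DA; apply: Ck_comp_mx => // i j; apply: Ck_linear => a M N.
by rewrite coords_map_linear // !mxE.
Qed.

Lemma continuous_coords_map (phi : F -> G) : linear phi ->
  continuous (fun M => coords (map_mx phi (@of_coords R F n M))).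
Proof. by move=> lphi; apply: linear_mx_continuous; exact: coords_map_linear. Qed.

End EntrywiseMaps.

Section Embedding.
Context {R : realType} (t : R) (n : nat).
Local Notation H := (splitquat R).
Local Notation K := (KK t).
Local Notation f := (@proj_emb R t n).
Implicit Types (z : goodvec K n) (U : set (projspace K n)).

Lemma proj_emb_projpt z : f (projpt z) = projpt (good_emb z).
Proof.
have /projptP[a Ua az] := projpt_repr (projpt z).
apply/projptP; exists (vsval a); first exact/vsval_unit.
by rewrite /= az; apply/rowP => i; rewrite !mxE.
Qed.

Definition K_weight (w : 'I_n.+1 -> K) : 'I_n.+1 -> H := fun i => vsval (w i).

Lemma dot_incl w (u : 'rV[K]_n.+1) : dot (K_weight w) (K_incl u) = vsval (dot w u).
Proof. by rewrite linear_sum; apply: eq_bigr => i _; rewrite mxE. Qed.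

Lemma proj_emb_injective : injective f.
Proof.
move=> x y; rewrite -(projpt_repr x) -(projpt_repr y) !proj_emb_projpt.
move: (repr x) (repr y) => u v /projptP[a Ua va].
have /asboolP/(_ 1)[w uw] := valP u.
(* As u.w = 1 and v = a u, the scalar a = v.w lies in K. *)
have aE : a = vsval (dot w (val v)).
  by rewrite -dot_incl -[K_incl _]/(val (good_emb v)) va dotZ dot_incl /dot uw vsval_K1 mulr1.
apply/projptP; exists (dot w (val v)); first by apply/vsval_unit; rewrite -aE.
apply/rowP => i; apply: val_inj; move: va => /rowP/(_ i).
by rewrite !mxE aE.
Qed.

Lemma continuous_proj_emb : continuous f.
Proof.
apply/quotient_continuous.
rewrite (_ : f \o _ = @projpt R H n \o @good_emb R t n); last first.
  by apply/funext => z /=; exact: proj_emb_projpt.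
move=> z; apply: continuous_comp; last exact: continuous_projpt.
move: z; apply: continuous_comp_initial.
pose L M := coords (map_mx vsval (@of_coords R K n M)) : 'M[R]_(n.+1, \dim {:H}).
rewrite (_ : _ \o _ = L \o (fun z => coords (val z))).
  move=> z; apply: continuous_comp; first exact: continuous_coords.
  by apply: continuous_coords_map => a b c; rewrite linearP.
by apply/funext => z; rewrite /= /L coordsK.
Qed.

Lemma open_K_cone U : open U -> open (cone U).
Proof. exact: (open_cone (@K_norm_linear R t) (@K_star_linear R t) (@K_unitP R t)). Qed.

Definition retract_mx (M : 'M[R]_(n.+1, \dim {:H})) : 'M[R]_(n.+1, \dim {:K}) :=
  coords (map_mx (@K_retraction R t) (of_coords M)).

(** Both (u.w)^-1 and u have entries in K, where the retraction is the identity. *)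
Lemma retract_normalize w (u : 'rV[K]_n.+1) : dot w u \is a GRing.unit ->
  map_mx (@K_retraction R t) (normalize (K_weight w) (K_incl u)) = (dot w u)^-1 *: u.
Proof.
move=> Uu; apply/rowP => i; rewrite !mxE dot_incl -vsvalV //.
exact: (K_retractionK ((dot w u)^-1 * u 0 i)).
Qed.

Lemma good_scale (a : K) z : a \is a GRing.unit -> `[< good (a *: val z) >].
Proof.
move=> Ua; have /asboolP gz := valP z; apply/asboolP => b.
have [v zv] := gz (a^-1 * b); exists v; rewrite -[RHS](mulVKr Ua) -zv mulr_sumr.
by apply: eq_bigr => i _; rewrite mxE mulrA.
Qed.

Lemma normalized_projpt w z : dot w (val z) \is a GRing.unit ->
  exists z', (dot w (val z))^-1 *: val z = val z' /\ projpt z' = projpt z.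
Proof.
move=> Uz; have Ud : (dot w (val z))^-1 \is a GRing.unit by rewrite unitrV.
pose z' : goodvec K n := exist _ ((dot w (val z))^-1 *: val z) (good_scale z Ud).
exists z'; split=> //.
apply/projptP; exists (dot w (val z)) => //=.
by rewrite scalerA mulrV // scale1r.
Qed.

(** On the image of the embedding the retraction undoes the embedding, so this open
    set of the target cuts out there the part of U in the chart of w. *)
Lemma chart_incl w U z :
  chart (K_weight w) (retract_mx @^-1` cone U) (coords (val (good_emb z))) <->
  dot w (val z) \is a GRing.unit /\ U (projpt z).
Proof.
rewrite /chart /= coordsK dot_incl vsval_unit.
split=> -[Uz Az]; split=> //; move: Az; rewrite /retract_mx /= coordsK retract_normalize //;
  have [z' [-> <-]] := normalized_projpt Uz; by move/coneE.
Qed.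

Lemma open_retract_cone U : open U -> open (retract_mx @^-1` cone U).
Proof.
move=> oU; apply: open_comp; last exact: open_K_cone.
by move=> M _; apply: continuous_coords_map; exact: K_retraction_linear.
Qed.

Lemma good_weight z : exists w : 'I_n.+1 -> K, dot w (val z) \is a GRing.unit.
Proof. by have /asboolP/(_ 1)[w zw] := valP z; exists w; rewrite /dot zw unitr1. Qed.

(** An open set U is the preimage of the union, over all weights w over K, of the
    points of the chart of w whose retraction lies in U. *)
Lemma topological_embedding_proj_emb : topological_embedding f.
Proof.
split; [exact: continuous_proj_emb|exact: proj_emb_injective|move=> U oU].
exists (\bigcup_w proj_chart (K_weight w) (retract_mx @^-1` cone U)).
  by apply: bigcup_open => w _; apply: open_proj_chart; exact: open_retract_cone.
apply/funext => x; apply/propext; rewrite -(projpt_repr x).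
rewrite /preimage /= proj_emb_projpt; move: (repr x) => z.
split=> [[w _ /proj_chartP/chart_incl[]//]|Uz].
have [w Uw] := good_weight z; exists w => //.
by apply/proj_chartP/chart_incl.
Qed.

(** In coordinates the embedding is a linear map between cones of good vectors. *)
Lemma smooth_proj_emb x : smooth_map_at (@smooth_near R K n) (@smooth_near R H n) f x.
Proof.
split=> [|h [U [oU Ux sh]]]; first exact: continuous_proj_emb.
exists (f @^-1` U); have oV : open (f @^-1` U).
  by apply: open_comp => // y _; exact: continuous_proj_emb.
have oC := open_K_cone oV.
have lv : linear (@vsval R H (Kalg t)) by move=> a b c; rewrite linearP.
have inclE z : coords (map_mx vsval (@of_coords R K n (coords (val z)))) =
    coords (val (good_emb z)).
  by rewrite coordsK.
split=> // k.
apply: eq_Ck (Ck_coords_map lv oC _ (sh k)) => // M /coneP[z [-> Uz]]; rewrite inclE.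
  by rewrite !cone_fun_coords /= proj_emb_projpt.
by apply/coneE; rewrite -proj_emb_projpt.
Qed.

(** The composite of h with the local left inverse of the embedding in the chart
    of w.  Outside the chart, or where the retracted vector is not good, the value
    is arbitrary. *)
Definition retract_fun w (h : projspace K n -> R) : projspace H n -> R :=
  fun y => cone_fun h (retract_mx (coords (normalize (K_weight w) (val (repr y))))).

Lemma retract_fun_projpt w h A (v : goodvec H n) : chart (K_weight w) A (coords (val v)) ->
  retract_fun w h (projpt v) = cone_fun h (retract_mx (coords (normalize (K_weight w) (val v)))).
Proof.
rewrite /chart /= !coordsK => -[Uv _]; rewrite /retract_fun.
have /esym/projptP[a Ua ->] := projpt_repr (projpt v).
by rewrite normalizeZ.
Qed.

Lemma retract_fun_emb w h z : dot w (val z) \is a GRing.unit ->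
  retract_fun w h (f (projpt z)) = h (projpt z).
Proof.
move=> Uz; rewrite proj_emb_projpt (@retract_fun_projpt w h setT); last first.
  by rewrite /chart /= coordsK dot_incl vsval_unit.
rewrite /retract_mx coordsK retract_normalize //.
by have [z' [-> <-]] := normalized_projpt Uz; rewrite cone_fun_coords.
Qed.

Lemma smooth_retract_fun w h z : dot w (val z) \is a GRing.unit ->
  smooth_near (projpt z) h -> smooth_near (f (projpt z)) (retract_fun w h).
Proof.
move=> Uz [U [oU Uz' sh]]; rewrite proj_emb_projpt.
have oA := open_retract_cone oU.
apply: (smooth_near_normalized (g := cone_fun h \o retract_mx) oA).
- by move=> k; apply: (Ck_coords_map (@K_retraction_linear R t) oA _ (sh k)).
- by move=> v; exact: retract_fun_projpt.
- exact/chart_incl.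
Qed.

Lemma near_eq_derive1 (g1 g2 : R -> R^o) (a : R) : (\forall s \near a, g1 s = g2 s) ->
  derive1 g1 a = derive1 g2 a.
Proof. by move=> g12; rewrite !derive1E; exact: near_eq_derive. Qed.

(** Near 0, a curve c in the source stays in the chart of a weight w adapted to c(0),
    where h o c is the composite of [retract_fun w h] with the image of c.  Equality
    of velocities in the target, tested on [retract_fun w h], is thus equality of the
    derivatives of h along the two curves. *)
Lemma immersion_proj_emb : immersion (@smooth_near R K n) (@smooth_near R H n) f.
Proof.
split=> [|c1 c2 sc1 sc2 c12 [_ vel]]; first exact: smooth_proj_emb.
split=> // h.
have [z c1z] : exists z, projpt z = c1 0 by exists (repr (c1 0)); exact: projpt_repr.
have [w Uw] := good_weight z.
rewrite -c1z => /(smooth_retract_fun Uw); rewrite c1z => /vel.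
have rf c : smooth_curve (@smooth_near R K n) c -> c 0 = projpt z ->
    derive1 ((retract_fun w h) \o (f \o c) : R -> R^o) 0 = derive1 (h \o c : R -> R^o) 0.
  move=> /nbhs_singleton[cc _] c0; apply: near_eq_derive1.
  pose W := f @^-1` proj_chart (K_weight w) setT.
  have oW : open W.
    apply: open_comp; first by move=> y _; exact: continuous_proj_emb.
    by apply: open_proj_chart; exact: openT.
  have : nbhs (c 0) W.
    apply: open_nbhs_nbhs; split=> //; rewrite /W /preimage /= c0 proj_emb_projpt.
    by apply/proj_chartP; rewrite /chart /= coordsK dot_incl vsval_unit.
  move=> /cc cW; near=> s.
  have : W (c s) by near: s; exact: cW.
  rewrite /= /W /preimage /= -(projpt_repr (c s)).
  rewrite proj_emb_projpt => /proj_chartP; rewrite /chart /= coordsK dot_incl vsval_unit => -[Us _].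
  by rewrite -proj_emb_projpt retract_fun_emb.
have c2z : c2 0 = projpt z by rewrite -c12 c1z.
by move=> E; rewrite -(rf c1 sc1 (esym c1z)) -(rf c2 sc2 c2z).
Unshelve. all: by end_near. Qed.

End Embedding.

(** * Curves and velocities *)
Section Curves.
Context {R : realType} (F : falgType R) (n : nat).
Variables (N : F -> R^o) (star : F -> F).
Hypotheses (lN : linear N) (lstar : linear star).
Hypothesis unitN : forall a : F, a \is a GRing.unit <-> N (a * star a) != 0.

Lemma near_good_line (p : goodvec F n) (v : 'rV[F]_n.+1) :
  \forall e \near (0 : R), `[< good (val p + (e%:A : F) *: v) >].
Proof.
pose M (e : R) := coords (val p) + e *: coords v.
have cM : {for 0, continuous M}.
  by apply: cvgD; [exact: cvg_cst|apply: cvgZ; [exact: cvg_id|exact: cvg_cst]].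
have oG := open_good (n := n) lN lstar unitN.
have GM : \forall e \near (0 : R), [set coords (val u) | u in @setT (goodvec F n)] (M e).
  by apply: cM; apply: open_nbhs_nbhs; split=> //; exists p => //; rewrite /M scale0r addr0.
apply: filterS GM => e [u _].
rewrite /M -coords_line => /(can_inj (@coordsK R F n)) <-; exact: (valP u).
Qed.

End Curves.

Lemma near_same_velocity (R : realType) (T : topologicalType)
    (smT : T -> (T -> R) -> Prop) (c1 c2 : R -> T) :
  (\forall e \near (0 : R), c1 e = c2 e) -> same_velocity smT c1 c2.
Proof.
move=> c12; split=> [|h _]; first exact: (nbhs_singleton c12).
by apply: near_eq_derive1; apply: filterS c12 => e /= ->.
Qed.

Lemma same_velocity_sym (R : realType) (T : topologicalType)
    (smT : T -> (T -> R) -> Prop) (c1 c2 : R -> T) :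
  same_velocity smT c1 c2 -> same_velocity smT c2 c1.
Proof. by move=> [c12 v12]; split=> // h; rewrite -c12 => /v12. Qed.

Lemma same_velocity_trans (R : realType) (T : topologicalType)
    (smT : T -> (T -> R) -> Prop) (c1 c2 c3 : R -> T) :
  same_velocity smT c1 c2 -> same_velocity smT c2 c3 -> same_velocity smT c1 c3.
Proof.
move=> [c12 v12] [c23 v23]; split=> [|h sh]; first by rewrite c12.
by rewrite v12 // v23 // -c12.
Qed.

(** * The metric on the regular region *)
Section HermitianForm.
Context {R : realType} (F : falgType R) (star : F -> F).
Implicit Types u v : 'rV[F]_2.

Lemma herm_dot u v : herm star u v = dot (fun i => star (v 0 i)) u.
Proof.
rewrite /dot !big_ord_recl big_ord0 addr0.
by congr (_ + u 0 _ * star (v 0 _)); apply: val_inj.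
Qed.

Lemma hermZl a u v : herm star (a *: u) v = a * herm star u v.
Proof. by rewrite !herm_dot dotZ. Qed.

Lemma hermDl u u' v : herm star (u + u') v = herm star u v + herm star u' v.
Proof. by rewrite /herm !mxE !mulrDl addrACA. Qed.

Lemma hermZr a u v : (forall x y, star (x * y) = star y * star x) ->
  herm star u (a *: v) = herm star u v * star a.
Proof. by move=> starM; rewrite /herm !mxE !starM mulrDl !mulrA. Qed.

End HermitianForm.

Section Isometry.
Context {R : realType} (t : R).
Local Notation H := (splitquat R).
Local Notation K := (KK t).
Local Notation f := (@proj_emb R t 1).
Local Notation hermH := (herm (@sq_star R)).
Local Notation hermK := (herm (@K_star R t)).

Lemma herm_incl (u v : 'rV[K]_2) : hermH (K_incl u) (K_incl v) = vsval (hermK u v).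
Proof. by rewrite /herm !mxE. Qed.

Lemma herm_self (u : 'rV[H]_2) : hermH u u = (sq_norm (u 0 0) + sq_norm (u 0 1))%:A.
Proof. by rewrite [RHS]scalerDl /herm !sq_mulstar. Qed.

Lemma sq_norm_star (u : H) : sq_norm (sq_star u) = sq_norm u.
Proof. by rewrite /sq_norm /=; ring. Qed.

Lemma scalar_unit (c : R) : c != 0 -> (c%:A : H) \is a GRing.unit /\ (c%:A : H)^-1 = (c^-1)%:A.
Proof.
move=> c0; have Uc : (c%:A : H) \is a GRing.unit.
  by apply/unitrP; exists (c^-1)%:A; rewrite !mulr_algl !scalerA mulVf // mulfV // scale1r.
split=> //; apply: (mulrI Uc).
by rewrite mulrV // mulr_algl scalerA mulfV // scale1r.
Qed.

(** The tangent curve of a map phi at q involves only v = phi(q). *)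
Definition line_curve (q : goodvec H 1) (v : 'rV[H]_2) (e : R) : projspace H 1 :=
  projpt (insubd q (val q + (e%:A : H) *: v)).

Lemma near_good_lineH (q : goodvec H 1) (v : 'rV[H]_2) :
  \forall e \near (0 : R), `[< good (val q + (e%:A : H) *: v) >].
Proof. exact: (near_good_line (@sq1_linear R) (@sq_star_linear R) (@sq_unitP R)). Qed.

Lemma derive1_affine (x y : R) : derive1 (fun e => x + e * y : R^o) (0 : R) = y.
Proof.
rewrite derive1E (_ : (fun e : R => _) = (cst x : R -> R^o) + (id : R -> R^o) * cst y) //.
rewrite deriveD // deriveM // !derive_cst derive_id.
by rewrite scaler0 add0r add0r [LHS]mulr1.
Qed.

(** In the chart of weight w = q^*, orthogonality of v to q gives (q + e v).w = <q,q>
    for all e, so the curve is the affine line <q,q>^-1 (q + e v), and the real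
    coordinates in this chart are smooth functions which recover v. *)
Lemma line_curve_inj (q : goodvec H 1) (v v' : 'rV[H]_2) :
  hermH (val q) (val q) != 0 -> hermH v (val q) = 0 -> hermH v' (val q) = 0 ->
  same_velocity (@smooth_near R H 1) (line_curve q v) (line_curve q v') -> v = v'.
Proof.
rewrite herm_self; set c := _ + _ => c0.
have {}c0 : c != 0 by apply: contra_neq c0 => ->; rewrite scale0r.
have [Uc cV] := scalar_unit c0.
pose w i := sq_star (val q 0 i).
have hw u : hermH u (val q) = dot w u by exact: herm_dot.
rewrite !hw => vq v'q [_ vel].
have wq : dot w (val q) = c%:A by rewrite -hw herm_self.
have lineE u : dot w u = 0 -> forall e : R, dot w (val q + (e%:A : H) *: u) = c%:A.
  by move=> uq e; rewrite -hw hermDl hermZl !hw uq wq mulr0 addr0.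
have normE u : dot w u = 0 -> forall e : R, normalize w (val q + (e%:A : H) *: u) =
    (c^-1)%:A *: (val q + (e%:A : H) *: u).
  by move=> uq e; rewrite /normalize lineE // cV.
suff test (l : H -> R^o) (i : 'I_2) : linear l -> l (v 0 i) = l (v' 0 i).
  apply/rowP => i; apply: sq_eq; [exact: (test (@sq1 R))|exact: (test (@sqi R))|
    exact: (test (@sqj R))|exact: (test (@sqk R))].
move=> ll; have lD x y : l (x + y) = l x + l y by rewrite -[x]scale1r ll !scale1r.
have l0 : l 0 = 0 by have := lD 0 0; rewrite addr0 -{1}[l 0]addr0 => /addrI.
have lZ a x : l (a *: x) = a * l x by rewrite -[a *: x]addr0 ll l0 addr0.
(* A real coordinate of the representative in the chart. *)
pose h (y : projspace H 1) : R := l (normalize w (val (repr y)) 0 i).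
have hE (u : goodvec H 1) : dot w (val u) \is a GRing.unit ->
    h (projpt u) = l (normalize w (val u) 0 i).
  move=> Uu; rewrite /h; have /esym/projptP[a Ua ->] := projpt_repr (projpt u).
  by rewrite normalizeZ.
have Uq : chart w setT (coords (val q)) by rewrite /chart /= coordsK wq.
have sh : smooth_near (projpt q) h.
  pose g M : R^o := l (@of_coords R H 1 M 0 i).
  apply: (smooth_near_normalized (g := g) openT _ _ Uq).
    by move=> k; apply: Ck_linear => a M M'; rewrite /g of_coords_linear ll.
  by move=> u [+ _]; rewrite /g !coordsK; exact: hE.
have dh u : dot w u = 0 -> derive1 (h \o line_curve q u : R -> R^o) 0 = c^-1 * l (u 0 i).
  move=> uq; rewrite -(derive1_affine (c^-1 * l (val q 0 i)) (c^-1 * l (u 0 i))).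
  apply: near_eq_derive1; near=> e.
  have ge : `[< good (val q + (e%:A : H) *: u) >] by near: e; exact: near_good_lineH.
  rewrite /= /line_curve hE insubdK ?lineE //.
  by rewrite normE // !mxE !mulr_algl lZ lD lZ mulrDr mulrCA.
have sh0 : smooth_near (line_curve q v 0) h by rewrite /line_curve scale0r scale0r addr0 valKd.
have := etrans (esym (dh v vq)) (etrans (vel h sh0) (dh v' v'q)).
by apply: mulfI; rewrite invr_eq0.
Unshelve. all: by end_near. Qed.

(** Left multiplication by a identifies p + e v with q + e (a v); both vectors are
    good for small e. *)
Lemma push_curve (p : goodvec K 1) (q : goodvec H 1) (a : H) (v : 'rV[K]_2) :
  a \is a GRing.unit -> val q = a *: K_incl (val p) ->
  \forall e \near (0 : R),
    f (projpt (insubd p (val p + (e%:A : K) *: v))) = line_curve q (a *: K_incl v) e.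
Proof.
move=> Ua qa; near=> e.
have gK : `[< good (val p + (e%:A : K) *: v) >].
  near: e; exact: (near_good_line (@K_norm_linear R t) (@K_star_linear R t) (@K_unitP R t)).
have gH : `[< good (val q + (e%:A : H) *: (a *: K_incl v)) >].
  by near: e; exact: near_good_lineH.
rewrite proj_emb_projpt; apply/projptP; exists a => //.
rewrite [LHS]insubdK // qa -[val (good_emb _)]/(K_incl (val _)) insubdK //.
apply/rowP => i; rewrite !mxE.
rewrite !mulr_algl -[vsval (_ + _)]/(vsval (val p 0 i) + e *: vsval (v 0 i)).
by rewrite mulrDr scalerAr.
Unshelve. all: by end_near. Qed.

Lemma K_starM (a b : K) : K_star (a * b) = K_star b * K_star a.
Proof. by apply: val_inj; exact: sq_starM. Qed.

Lemma regular_herm (p : goodvec K 1) :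
  regular (@K_star R t) (projpt p) -> hermH (K_incl (val p)) (K_incl (val p)) != 0.
Proof.
move=> [p' /projptP[b Ub ->]].
rewrite hermZl (hermZr _ _ _ K_starM) herm_incl; apply: contra_neq => pp0.
have -> : hermK (val p) (val p) = 0 by apply: val_inj; exact: pp0.
by rewrite mul0r mulr0.
Qed.

(** The numerator a <v,v'> a^* has real part N(a) Re <v,v'>, and the denominator
    <q,q> = N(a) <p,p> is real. *)
Lemma metric_incl (p : goodvec K 1) (q : goodvec H 1) (a : H)
    (phi psi : 'rV[K]_2 -> 'rV[K]_2) (phi' psi' : 'rV[H]_2 -> 'rV[H]_2) :
  hermH (K_incl (val p)) (K_incl (val p)) != 0 ->
  a \is a GRing.unit -> val q = a *: K_incl (val p) ->
  phi' (val q) = a *: K_incl (phi (val p)) -> psi' (val q) = a *: K_incl (psi (val p)) ->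
  metric (@sq_star R) (val q) phi' psi' = vsval (metric (@K_star R t) (val p) phi psi).
Proof.
move=> pp0 /[dup] Ua /sq_unitP Na qa phiq psiq.
rewrite /metric vsval_Repart RepartE; congr (_%:A).
rewrite phiq psiq {}qa !hermZl !(hermZr _ _ _ (@sq_starM R)) !herm_incl.
set x := hermK _ _; set y := hermK (val p) _.
have [r yr] : exists r : R, vsval y = r%:A by eexists; rewrite -herm_incl herm_self.
have r0 : r != 0 by apply: contra_neq pp0 => r0; rewrite herm_incl -/y yr r0 scale0r.
have Uy : y \is a GRing.unit by apply/vsval_unit; rewrite yr; exact: (scalar_unit r0).1.
rewrite [vsval (x / y)]vsvalM vsvalV // yr (scalar_unit r0).2.
have -> : a * (r%:A * sq_star a) = (r * sq_norm a)%:A.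
  by rewrite mulr_algl -scalerAr sq_mulstar scalerA.
rewrite (scalar_unit _).2 ?mulf_neq0 //.
rewrite !mulr_algr /= invfM -mulrA; congr (_ * _).
(* The real part of a x a^* is N(a) times that of x. *)
apply: (mulfI Na); rewrite mulrA mulfV // mul1r /sq_norm /=; ring.
Qed.

(** The map phi is pushed to the linear map sending q to a phi(p); by injectivity of
    v |-> [q + e v] on velocities, every map to which phi is pushed takes this value
    at q. *)
Lemma isometric_proj_emb : isometric_on_regular f.
Proof.
move=> p /regular_herm pp0; split.
  by exists (good_emb p); first exact: proj_emb_projpt.
move=> q; rewrite proj_emb_projpt => /esym/projptP[a Ua qa] pushes.
have qq0 : hermH (val q) (val q) != 0.
  apply: contra_neq pp0; rewrite qa hermZl (hermZr _ _ _ (@sq_starM R)) => qq.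
  have Usa : sq_star a \is a GRing.unit.
    by apply/sq_unitP; rewrite sq_norm_star; exact/sq_unitP.
  by apply: (mulrI Ua); apply: (mulIr Usa); rewrite -mulrA qq mulr0 mul0r.
have Uqq : hermH (val q) (val q) \is a GRing.unit.
  move: qq0; rewrite herm_self; set c := _ + _ => c0.
  by apply: (scalar_unit _).1; apply: contra_neq c0 => ->; rewrite scale0r.
have line_p : exists b : K, val p = b *: val p by exists 1; rewrite scale1r.
have line_q : exists b : H, val q = b *: val q by exists 1; rewrite scale1r.
have orth phi : tangent_map (@K_star R t) (val p) phi ->
    hermH (a *: K_incl (phi (val p))) (val q) = 0.
  move=> [_ /(_ _ line_p) phip]; rewrite qa hermZl (hermZr _ _ _ (@sq_starM R)).
  by rewrite herm_incl phip mul0r mulr0.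
have push_velocity phi : same_velocity (@smooth_near R H 1)
    (f \o tangent_curve p phi) (line_curve q (a *: K_incl (phi (val p)))).
  by apply: near_same_velocity; exact: push_curve.
have pushE phi phi' : tangent_map (@K_star R t) (val p) phi ->
    tangent_map (@sq_star R) (val q) phi' -> pushes phi phi' ->
    phi' (val q) = a *: K_incl (phi (val p)).
  move=> Tphi [_ /(_ _ line_q) phiq] push.
  apply: (line_curve_inj qq0 phiq (orth _ Tphi)).
  exact: same_velocity_trans (same_velocity_sym push) (push_velocity phi).
split=> [phi Tphi|phi psi phi' psi' Tphi Tpsi Tphi' Tpsi' push_phi push_psi]; last first.
  by apply: (metric_incl pp0 Ua qa); exact: pushE.
pose phi' u := (hermH u (val q) / hermH (val q) (val q)) *: (a *: K_incl (phi (val p))).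
have phiq : phi' (val q) = a *: K_incl (phi (val p)) by rewrite /phi' mulrV // scale1r.
have curveE : tangent_curve q phi' = line_curve q (a *: K_incl (phi (val p))).
  by apply/funext => e; rewrite /tangent_curve phiq.
exists phi'; last by rewrite /pushes curveE; exact: push_velocity.
split=> [b u v _ _|u _].
  by rewrite /phi' hermDl hermZl mulrDl scalerDl -mulrA -[in LHS]scalerA.
by rewrite /phi' hermZl (orth phi Tphi) mulr0.
Qed.

End Isometry.

(** * The isomorphism type of K *)
Section Isomorphisms.
Context {R : realType} (t : R).
Local Notation K := (KK t).

(** The hypotheses say that 1, tau is a real basis of B, that tau satisfies the
    quadratic equation of sigma(t), and that the involution negates tau; then
    a + b sigma(t) |-> a + b tau is an isomorphism. *)
Section Generator.
Variables (B : lalgType R) (starB : B -> B) (tau : B) (re im : B -> R).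
Hypothesis tau_sqr : tau * tau = (2 * t - 1)%:A.
Hypothesis tau_comm : forall a : R, tau * a%:A = a *: tau.
Hypothesis B_coord : forall x, x = (re x)%:A + im x *: tau.
Hypothesis B_free : forall a b : R, a%:A + b *: tau = 0 -> a = 0 /\ b = 0.
Hypothesis starBE : forall a b : R, starB (a%:A + b *: tau) = a%:A - b *: tau.

Let f (z : K) : B := (sq1 (vsval z))%:A + (sqi (vsval z) + sqj (vsval z)) *: tau.

Lemma generatorD (a x y x' y' : R) :
  a *: (x%:A + y *: tau) + (x'%:A + y' *: tau) = (a * x + x')%:A + (a * y + y') *: tau.
Proof. by rewrite scalerDr !scalerA addrACA -!scalerDl. Qed.

Lemma generatorM (a b c d : R) :
  (a%:A + b *: tau) * (c%:A + d *: tau) =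
  (a * c + b * d * (2 * t - 1))%:A + (a * d + b * c) *: tau.
Proof.
have tau_scale (x : R) : tau * (x *: tau) = (x * (2 * t - 1))%:A.
  by rewrite -tau_comm mulrA tau_sqr mulr_algl scalerA mulrC.
move: (2 * t - 1) tau_scale => e tau_scale.
rewrite mulrDl !mulrDr !mulr_algl -!scalerAl tau_comm tau_scale !scalerA.
by rewrite [X in _ + X]addrC addrACA -!scalerDl mulrA.
Qed.

Let f_linear : linear f.
Proof.
move=> a x y; rewrite generatorD /f -[vsval (a *: x + y)]/(a *: vsval x + vsval y) /=.
by congr (_ *: _ + _ *: _); ring.
Qed.

Let f_monoid : monoid_morphism f.
Proof.
split; first by rewrite /f vsval_K1 /= addr0 scale1r scale0r addr0.
move=> x y; rewrite generatorM /f vsvalM.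
have /KspaceP[a [b ->]] := valP x; have /KspaceP[c [d ->]] := valP y => /=.
by congr (_ *: _ + _ *: _); ring.
Qed.

Let g (x : B) : K := vsproj (Kalg t) ((re x)%:A + im x *: sigma t).

Let vsval_g x : vsval (g x) = (re x)%:A + im x *: sigma t.
Proof. by apply: vsprojK; apply/KspaceP; exists (re x), (im x). Qed.

Let f_inj : injective f.
Proof.
move=> x y fxy; apply/eqP; rewrite -subr_eq0; apply/eqP.
have : f (x - y) = 0.
  by have := f_linear (-1) y x; rewrite !scaleN1r fxy addNr addrC.
rewrite /f => /B_free[re0 im0]; apply: val_inj.
by rewrite -[LHS]retraction_vsval /retraction re0 im0 !scale0r addr0.
Qed.

Let gK : cancel g f.
Proof.
move=> x; rewrite [RHS]B_coord /f vsval_g /=.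
by congr (_ *: _ + _ *: _); ring.
Qed.

Lemma generator_star_isomorphic :
  star_isomorphic (A := K) (B := B) (@K_star R t) starB.
Proof.
pose fL := GRing.isLinear.Build _ _ _ _ _ f_linear.
pose fM := GRing.isMonoidMorphism.Build _ _ _ f_monoid.
pose F : {lrmorphism K -> B} := HB.pack f fL fM.
exists F; split; first by exists g => //; exact: inj_can_sym.
move=> x; rewrite /= /f starBE -scaleNr /=.
by congr (_ *: _ + _ *: _); ring.
Qed.

End Generator.

(** Here tau = i s with s^2 = 1 - 2t. *)
Lemma complex_star_isomorphic : t < 2^-1 ->
  star_isomorphic (A := K) (B := Rcomplex R) (@K_star R t) (@conjc R).
Proof.
move=> tlt; pose s := Num.sqrt (1 - 2 * t).
have s2 : s * s = 1 - 2 * t by rewrite -expr2 sqr_sqrtr //; lra.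
have s0 : s != 0 by apply: lt0r_neq0; rewrite sqrtr_gt0; lra.
have E (a b : R) : a%:A + b *: (Complex 0 s : Rcomplex R) = Complex a (b * s) :> Rcomplex R.
  by apply/eqP; rewrite eq_complex /=; apply/andP; split; apply/eqP; ring.
apply: (@generator_star_isomorphic (Rcomplex R) _ (Complex 0 s)
  (@complex.Re R) (fun z => complex.Im z / s)).
- rewrite -[RHS]addr0 -(scale0r (Complex 0 s : Rcomplex R)) E.
  by apply/eqP; rewrite eq_complex /=; apply/andP; split; apply/eqP; rewrite ?s2; ring: s2.
- move=> a; rewrite -[RHS]add0r -(scale0r (1 : Rcomplex R)) E.
  rewrite -[a%:A]addr0 -(scale0r (Complex 0 s : Rcomplex R)) E.
  by apply/eqP; rewrite eq_complex /=; apply/andP; split; apply/eqP; ring.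
- by case=> a b; rewrite E /= divfK.
- by move=> a b; rewrite E => -[-> /eqP]; rewrite mulf_eq0 (negPf s0) orbF => /eqP.
- move=> a b; rewrite -scaleNr !E /=.
  by apply/eqP; rewrite eq_complex /=; apply/andP; split; apply/eqP; ring.
Qed.

(** Here tau is s times the class of x in R[x]/(x^2 - c): the dual numbers are the
    case c = 0 and s = 1, the split-complex numbers the case c = 1 and
    s^2 = 2t - 1. *)
Lemma qpoly_star_isomorphic (h : {poly R}) (c s : R) : h = 'X^2 - c%:P -> s != 0 ->
  s * s * c = 2 * t - 1 ->
  star_isomorphic (A := K) (B := {poly %/ h}) (@K_star R t) (@qpoly_star R h).
Proof.
move=> hE s0 s2c.
have sh : size h = 3.
  by rewrite hE size_polyDl size_polyXn // size_polyN (leq_ltn_trans (size_polyC_leq1 _)).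
have mh : h \is monic.
  rewrite monicE lead_coefE sh hE coefB coefXn coefC /=.
  by rewrite subr0.
have mkh : mk_monic h = h by rewrite /mk_monic sh mh.
pose L (a b : R) : {poly R} := a%:P + b *: 'X.
have size_L a b : (size (L a b) < size (mk_monic h))%N.
  rewrite mkh sh ltnS (leq_trans (size_polyD _ _)) // geq_max.
  rewrite (leq_trans (size_polyC_leq1 _)) // (leq_trans (size_scale_leq _ _)) //.
  by rewrite size_polyX.
have LE a b : in_qpoly h (L a b) = L a b :> {poly R} by rewrite in_qpoly_small.
pose tau := in_qpoly h (s *: 'X).
have E (a b : R) : a%:A + b *: tau = in_qpoly h (L a (b * s)).
  by rewrite /L /tau in_qpolyD -alg_polyC !in_qpolyZ in_qpoly1 scalerA.
apply: (@generator_star_isomorphic _ _ tau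
  (fun x => (x : {poly R})`_0) (fun x => (x : {poly R})`_1 / s)).
- rewrite /tau -in_qpolyM -scalerAl -scalerAr scalerA.
  rewrite (_ : 'X * 'X = h + c%:P); last by rewrite hE subrK expr2.
  rewrite in_qpolyZ in_qpolyD (_ : in_qpoly h h = 0); last first.
    by apply: val_inj; rewrite /= mkh Pdiv.RingMonic.rmodpp.
  by rewrite add0r -alg_polyC in_qpolyZ in_qpoly1 scalerA s2c.
- by move=> a; rewrite mulrC mulr_algl.
- move=> x; rewrite E divfK //; apply: val_inj; rewrite /= -[RHS]/(in_qpoly h _ : {poly R}) LE.
  apply/polyP => i; rewrite coefD coefC coefZ coefX.
  case: i => [|[|i]] /=; rewrite ?mulr0 ?mulr1 ?addr0 ?add0r //.
  have smkh : size (mk_monic h) = 3 by rewrite mkh.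
  have := size_mk_monic x; rewrite [X in (_ < X)%N]smkh ltnS => sx.
  by rewrite nth_default // (leq_trans sx).
- move=> a b; rewrite E => L0; have /polyP Lab : L a (b * s) = 0 by rewrite -LE L0.
  have := Lab 0%N; have := Lab 1%N.
  rewrite !coefD !coefC !coefZ !coefX /= mulr0 mulr1 addr0 add0r => /eqP.
  by rewrite mulf_eq0 (negPf s0) orbF => /eqP -> ->.
- move=> a b; rewrite -scaleNr !E /qpoly_star LE; congr in_qpoly.
  by rewrite /L comp_polyD comp_polyC comp_polyZ comp_polyX mulNr scaleNr scalerN.
Qed.

End Isomorphisms.

Theorem mainTheorem3 (R : realType) (t : R) (t01 : 0 <= t <= 1) :
  [/\ (1 \in Kspace t) /\
      (forall u v, u \in Kspace t -> v \in Kspace t -> u * v \in Kspace t),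
      [/\ t < 2^-1 -> star_isomorphic (A := KK t) (B := Rcomplex R) (@K_star R t) (@conjc R),
          t = 2^-1 -> star_isomorphic (A := KK t) (B := dual_numbers R) (@K_star R t) (@qpoly_star R _)
        & 2^-1 < t ->
            star_isomorphic (A := KK t) (B := split_complex R) (@K_star R t) (@qpoly_star R _)],
      (forall n : nat,
         (forall z : goodvec (KK t) n, proj_emb (projpt z) = projpt (good_emb z)) /\
         smooth_embedding (@smooth_near R (KK t) n) (@smooth_near R (splitquat R) n)
           (@proj_emb R t n))
    & isometric_on_regular (@proj_emb R t 1)].
Proof.
split; last exact: isometric_proj_emb.
- split=> [|u v Ku Kv]; first exact: Kspace1.
  exact: (memvM (A := Kalg t)).
- split; first exact: complex_star_isomorphic.
  + move=> t2; apply: (@qpoly_star_isomorphic _ _ _ 0 1); rewrite ?oner_eq0 //.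
      by rewrite subr0.
    by rewrite t2 mulr0 mulfV ?subrr // pnatr_eq0.
  + move=> t2; apply: (@qpoly_star_isomorphic _ _ _ 1 (Num.sqrt (2 * t - 1))) => //.
      by apply: lt0r_neq0; rewrite sqrtr_gt0; lra.
    by rewrite mulr1 -expr2 sqr_sqrtr //; lra.
- move=> n; split; first exact: proj_emb_projpt.
  by split; [exact: topological_embedding_proj_emb|exact: immersion_proj_emb].
Qed.
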